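(* Let $\sigma\in(0,2)$, $T>0$, $h>0$, $M\in\mathbb{N}$, $\tau=T/M$, and assume $F:\mathbb{R}\to\mathbb{R}$ satisfies $F(l_1)-F(l_2)\le L_F(l_1-l_2)^+$ for all $l_1,l_2\in\mathbb{R}$, with a constant $L_F>0$, and that the CFL condition $\tau\le\frac{1}{L_FC_\sigma}h^\sigma$ holds. Let $f_{\mathbf i}^n\in\mathbb{R}$ be given, and let $U=(U_{\mathbf i}^n)$ and $V=(V_{\mathbf i}^n)$ ($\mathbf i\in\mathbb{Z}^N$, $0\le n\le M$) be a subsolution and a supersolution, respectively, of the scheme $$U_{\mathbf i}^{n+1}=U_{\mathbf i}^n+\tau\Big[F\big(-(-\Delta_h)^{\sigma/2}U_{\mathbf i}^n\big)+f_{\mathbf i}^n\Big],\qquad \mathbf i\in\mathbb{Z}^N,\ 0\le n\le M-1.$$ If $U_{\mathbf j}^0\le V_{\mathbf j}^0$ for all $\mathbf j\in\mathbb{Z}^N$, then $U_{\mathbf j}^n\le V_{\mathbf j}^n$ for all $1\le n\le M$ and all $\mathbf j\in\mathbb{Z}^N$.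
   Context: $(\cdot)^+=\max\{0,\cdot\}$. On grid functions (indexed by $\mathbf i\in\mathbb{Z}^N$, corresponding to the points $h\mathbf i$), the power of the discrete Laplacian is $-(-\Delta_h)^{\sigma/2}U_{\mathbf i}=\sum_{\mathbf j\in\mathbb{Z}^N\setminus\{0\}}(U_{\mathbf i+\mathbf j}-U_{\mathbf i})\kappa_{\sigma,h,\mathbf j}$, where $\kappa_{\sigma,h,\mathbf j}=\frac{1}{h^\sigma}\frac{1}{|\Gamma(-\sigma/2)|}\int_0^\infty e^{-2Nt}\prod_{i=1}^NI_{|\mathbf j_i|}(2t)\frac{dt}{t^{1+\sigma/2}}\ge0$ and $I_m$ is the modified Bessel function of the first kind of order $m$. (Equivalently $-(-\Delta_h)^{\sigma/2}=\frac{1}{|\Gamma(-\sigma/2)|}\int_0^\infty(e^{t\Delta_h}-\mathrm{Id})\frac{dt}{t^{1+\sigma/2}}$ with $\Delta_h$ the standard second order central difference Laplacian of step $h$.) The constant $C_\sigma>0$ (independent of $h$) is defined by $\sum_{\mathbf j\ne0}\kappa_{\sigma,h,\mathbf j}=C_\sigma h^{-\sigma}$. A subsolution (supersolution) of the scheme is a grid function, for which all the series defining $-(-\Delta_h)^{\sigma/2}$ converge absolutely (e.g. a bounded one), that satisfies the scheme with ''$=$'' replaced by ''$\le$'' (''$\ge$''). *)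

(* Defs.v *)
From mathcomp Require Import all_boot all_order all_algebra.
From mathcomp Require Import all_classical all_reals all_analysis.

Set Implicit Arguments.
Unset Strict Implicit.
Unset Printing Implicit Defensive.

Import Order.TTheory GRing.Theory Num.Theory.
Import numFieldNormedType.Exports.

Local Open Scope classical_set_scope.
Local Open Scope ring_scope.

Section SpecialFunctions.
Context {R : realType}.

Definition Gamma_integral (x : R) : R :=
  \int[lebesgue_measure]_(t in `]0, +oo[) (t `^ (x - 1) * expR (- t)).

(* Number of steps of Gamma(x) = Gamma(x + 1) / x that bring x into the domain
   ]0, +oo[ of Euler's integral. *)
Definition Gamma_shift (x : R) : nat :=
  if 0 < x then 0%N else `|Num.floor (- x)|%N.+1.

(* Meaningful away from the poles 0, -1, -2, ..., where the division by zero
   yields 0. *)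
Definition Gamma (x : R) : R :=
  Gamma_integral (x + (Gamma_shift x)%:R)
    / \prod_(i < Gamma_shift x) (x + i%:R).

Definition BesselI (m : nat) (x : R) : R :=
  limn (series (fun k => (x / 2) ^+ (2 * k + m) / (k`! * (k + m)`!)%:R)).

End SpecialFunctions.

Section FractionalLaplacian.
Context {R : realType}.

Definition abs_convergent {I : choiceType} (D : set I) (a : I -> R) : Prop :=
  summable D (fun i => (a i)%:E).

(* The library's esum only handles nonnegative families; this is the sum of an
   absolutely convergent real family. *)
Definition rsum {I : choiceType} (D : set I) (a : I -> R) : R :=
  fine (\esum_(i in D) (Num.max 0 (a i))%:E)
  - fine (\esum_(i in D) (Num.max 0 (- a i))%:E).

Definition nonzero (N : nat) : set 'rV[int]_N := [set j | j != 0].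
Arguments nonzero : clear implicits.

Definition kappa (N : nat) (sigma h : R) (j : 'rV[int]_N) : R :=
  (h `^ sigma)^-1 * `|Gamma (- (sigma / 2))|^-1 *
  \int[lebesgue_measure]_(t in `]0, +oo[)
     (expR (- (2 * N%:R * t))
      * (\prod_(i < N) BesselI `|j ord0 i|%N (2 * t))
      / t `^ (1 + sigma / 2)).

Definition fracLap_term (N : nat) (sigma h : R) (U : 'rV[int]_N -> R)
    (i j : 'rV[int]_N) : R :=
  (U (i + j) - U i) * kappa sigma h j.

(* The operator -(-Delta_h)^(sigma/2), minus sign included. *)
Definition fracLap (N : nat) (sigma h : R) (U : 'rV[int]_N -> R)
    (i : 'rV[int]_N) : R :=
  rsum (nonzero N) (fracLap_term sigma h U i).

Definition fracLap_defined (N : nat) (sigma h : R) (U : 'rV[int]_N -> R) :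
    Prop :=
  forall i, abs_convergent (nonzero N) (fracLap_term sigma h U i).

(* The total mass of the weights at h = 1; rsum_kappa below is the defining
   relation for every h. *)
Definition C_sigma (N : nat) (sigma : R) : R :=
  rsum (nonzero N) (kappa sigma 1).

Section Scheme.
Variables (N M : nat) (sigma h tau : R) (F : R -> R).
Variable f : nat -> 'rV[int]_N -> R.

(* Time levels n > M of U are unconstrained.  The operator is applied only at
   the levels n < M. *)
Definition subsolution (U : nat -> 'rV[int]_N -> R) : Prop :=
  forall n, (n < M)%N ->
    fracLap_defined sigma h (U n) /\
    forall i, U n.+1 i <= U n i + tau * (F (fracLap sigma h (U n) i) + f n i).

Definition supersolution (V : nat -> 'rV[int]_N -> R) : Prop :=
  forall n, (n < M)%N ->
    fracLap_defined sigma h (V n) /\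
    forall i, V n.+1 i >= V n i + tau * (F (fracLap sigma h (V n) i) + f n i).

End Scheme.

Lemma ge0_rsumZl {I : choiceType} (D : set I) (c : R) (a : I -> R) :
  0 <= c -> rsum D (fun i => c * a i) = c * rsum D a.
Proof.
move=> c0.
have Z (b : I -> R) : fine (\esum_(i in D) (Num.max 0 (c * b i))%:E)
    = c * fine (\esum_(i in D) (Num.max 0 (b i))%:E).
  rewrite (eq_esum (b := fun i => c%:E * (Num.max 0 (b i))%:E)%E); last first.
    by move=> i _; rewrite -EFinM maxr_pMr// mulr0.
  have [->|c_neq0] := eqVneq c 0.
    by rewrite mul0r esum1// => i _; rewrite mul0e.
  rewrite /esum.
  have -> : [set (\sum_(x \in A) (c%:E * (Num.max 0 (b x))%:E))%E
              | A in fsets D]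
      = [set (c%:E * x)%E | x in
          [set (\sum_(x \in A) (Num.max 0 (b x))%:E)%E | A in fsets D]].
    rewrite image_comp; apply: eq_imagel => A [finA _] /=.
    by rewrite ge0_mule_fsumr// => i; rewrite lee_fin le_max lexx.
  have c_gt0 : 0 < c by rewrite lt_neqAle eq_sym c_neq0.
  rewrite ereal_sup_pZl//.
  by case: (ereal_sup _) => [r||] //=;
    rewrite ?gt0_muley ?gt0_muleNy ?lte_fin//= mulr0.
rewrite /rsum Z mulrBr; congr (_ - _).
by rewrite -Z; congr fine; apply: eq_esum => i _; rewrite mulrN.
Qed.

Lemma kappaE (N : nat) (sigma h : R) (j : 'rV[int]_N) :
  kappa sigma h j = h `^ (- sigma) * kappa sigma 1 j.
Proof. by rewrite /kappa powR1 invr1 mul1r powRN mulrA. Qed.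

Lemma rsum_kappa (N : nat) (sigma h : R) :
  rsum (nonzero N) (kappa sigma h) = C_sigma N sigma * h `^ (- sigma).
Proof.
rewrite mulrC -ge0_rsumZl ?powR_ge0//.
by congr rsum; apply/funext => j; exact: kappaE.
Qed.

End FractionalLaplacian.

(* Main.v *)
Require Import Defs.
From mathcomp Require Import all_boot all_order all_algebra.
From mathcomp Require Import all_classical all_reals all_analysis.
From mathcomp Require Import lra.

(** If [U^n <= V^n], then [(L U^n - L V^n)_i <= (V^n - U^n)_i C_sigma h^(-sigma)]
    with [L = -(-Delta_h)^(sigma/2)], because the weights are nonnegative and
    only the diagonal term can be positive.  Multiplied by [tau L_F], the right
    hand side is at most [(V^n - U^n)_i] by the CFL condition, so the scheme is
    monotone.  Summability of the weights need not be proved from their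
    integral representation: since [0 < tau], the CFL condition forces
    [C_sigma <> 0], whereas the sum of a divergent nonnegative family is the
    junk value [0]. *)

Import Order.TTheory GRing.Theory Num.Theory.
Local Open Scope ring_scope.

Lemma BesselI_ge0 (R : realType) (m : nat) (x : R) : 0 <= x -> 0 <= BesselI m x.
Proof.
move=> x0.
have x20 : 0 <= x / 2 by rewrite divr_ge0.
have u_ge0 k : 0 <= (x / 2) ^+ (2 * k + m) / (k`! * (k + m)`!)%:R.
  by rewrite divr_ge0// exprn_ge0.
rewrite /BesselI; apply: limr_ge; last first.
  by near=> n; rewrite /series/= sumr_ge0.
(* Convergence is needed to pass nonnegativity to the limit. Dropping [(k + m)!] from the
   denominator bounds the series by that of [(x/2)^m exp((x/2)^2)]. *)
apply: (@series_le_cvg _ _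
    (fun k => (x / 2) ^+ m * exp_coeff ((x / 2) ^+ 2) k)) => // [k|k|].
- by rewrite mulr_ge0 ?exprn_ge0// /exp_coeff /= divr_ge0// exprn_ge0// exprn_ge0.
- rewrite /exp_coeff /= exprD exprM (mulrC (_ ^+ m)) -[leRHS]mulrAC.
  rewrite ler_wpM2l ?mulr_ge0 ?exprn_ge0//.
  rewrite lef_pV2 ?posrE ?ltr0n ?muln_gt0 ?fact_gt0// ler_nat.
  by rewrite leq_pmulr// fact_gt0.
- exact/is_cvg_seriesZ/is_cvg_series_exp_coeff.
Unshelve. all: by end_near.
Qed.

Lemma kappa_ge0 (R : realType) (N : nat) (sigma h : R) (j : 'rV[int]_N) :
  0 <= kappa sigma h j.
Proof.
rewrite /kappa !mulr_ge0 ?invr_ge0 ?powR_ge0//.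
apply: Rintegral_ge0 => t /=; rewrite in_itv/= andbT => t0.
rewrite divr_ge0 ?powR_ge0// mulr_ge0 ?expR_ge0// prodr_ge0// => i _.
by rewrite BesselI_ge0// mulr_ge0// ltW.
Qed.

Section RealFamilySums.
Context {R : realType} {I : choiceType} {D : set I}.
Implicit Types a b c : I -> R.

Lemma abs_convergentN {a} :
  abs_convergent D a -> abs_convergent D (fun i => - a i).
Proof.
by rewrite /abs_convergent /summable; under eq_esum do rewrite /= -normrN.
Qed.

(** The positive part is dominated by the absolute value. Finiteness lets the [fine] in [rsum] be
    undone. *)
Lemma esum_pos_fin_num {a} : abs_convergent D a ->
  (\esum_(i in D) (Num.max 0 (a i))%:E)%E \is a fin_num.
Proof.
move=> sa; rewrite ge0_fin_numE; last first.
  by apply: esum_ge0 => i _; rewrite lee_fin le_max lexx.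
apply: le_lt_trans sa; apply: le_esum => i _ /=.
by rewrite lee_fin ge_max normr_ge0 ler_norm.
Qed.

(** With all negative terms moved across, the inequality compares sums of nonnegative families,
    where [esum] is monotone and additive. *)
Lemma rsumB_le {a b c} :
  abs_convergent D a -> abs_convergent D b -> abs_convergent D c ->
  (forall i, D i -> a i - b i <= c i) -> rsum D a - rsum D b <= rsum D c.
Proof.
move=> sa sb sc abc.
have pos (g : I -> R) i : D i -> (0 <= (Num.max 0 (g i))%:E)%E.
  by move=> _; rewrite lee_fin le_max lexx.
have fa := esum_pos_fin_num sa; have fb := esum_pos_fin_num sb.
have fc := esum_pos_fin_num sc.
have fna := esum_pos_fin_num (abs_convergentN sa).
have fnb := esum_pos_fin_num (abs_convergentN sb).
have fnc := esum_pos_fin_num (abs_convergentN sc).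
have : (\esum_(i in D) ((Num.max 0 (a i))%:E + (Num.max 0 (- b i))%:E
          + (Num.max 0 (- c i))%:E)
    <= \esum_(i in D) ((Num.max 0 (c i))%:E + (Num.max 0 (- a i))%:E
          + (Num.max 0 (b i))%:E))%E.
  apply: le_esum => i Di; rewrite -!EFinD lee_fin.
  (* After this substitution the negative parts cancel, leaving [a i <= c i + b i]. *)
  have split (x : R) : Num.max 0 x = x + Num.max 0 (- x).
    by case: (lerP 0 x); case: (lerP 0 (- x)); lra.
  rewrite (split (a i)) (split (b i)) (split (c i)).
  by have := abc i Di; lra.
have posD (g g' : I -> R) i : D i ->
    (0 <= (Num.max 0 (g i))%:E + (Num.max 0 (g' i))%:E)%E.
  by move=> Di; rewrite adde_ge0// pos.
rewrite !esumD; try exact: pos; try exact: posD.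
rewrite /rsum -(fineK fa) -(fineK fb) -(fineK fc).
by rewrite -(fineK fna) -(fineK fnb) -(fineK fnc) -!EFinD lee_fin /=; lra.
Qed.

Lemma rsum_gt0_abs_convergent {a} :
  (forall i, 0 <= a i) -> 0 < rsum D a -> abs_convergent D a.
Proof.
move=> a0; rewrite /rsum /abs_convergent /summable.
have -> : (\esum_(i in D) (Num.max 0 (- a i))%:E = 0)%E.
  by apply: esum1 => i _; rewrite max_l// oppr_le0.
have -> : (\esum_(i in D) (Num.max 0 (a i))%:E
    = \esum_(i in D) `|(a i)%:E|)%E.
  by apply: eq_esum => i _ /=; rewrite max_r// ger0_norm.
by rewrite subr0; case: (esum _ _) => [r| |] //=; rewrite ?ltxx ?ltry.
Qed.

(** Natural multiples follow by repeated addition; a real factor is dominated by a natural number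
    above its absolute value. *)
Lemma abs_convergentZ (k : R) {a} :
  abs_convergent D a -> abs_convergent D (fun i => k * a i).
Proof.
move=> sa.
have san n : abs_convergent D (fun i => n%:R * a i).
  elim: n => [|n IH].
    by rewrite /abs_convergent /summable esum1// => i _; rewrite mul0r abse0.
  rewrite /abs_convergent.
  under [X in summable D X]eq_fun do rewrite -natr1 mulrDl mul1r EFinD.
  exact: summableD.
apply: le_lt_trans (san (Num.bound `|k|)); apply: le_esum => i _ /=.
rewrite lee_fin !normrM ler_wpM2r// [leRHS]ger0_norm//.
exact/ltW/archi_boundP.
Qed.

End RealFamilySums.

Lemma fracLapB_le (R : realType) (N : nat) (sigma h : R)
    (u v : 'rV[int]_N -> R) (i : 'rV[int]_N) :
  abs_convergent (@nonzero N) (kappa sigma h) ->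
  fracLap_defined sigma h u -> fracLap_defined sigma h v ->
  (forall j, u j <= v j) ->
  fracLap sigma h u i - fracLap sigma h v i
    <= (v i - u i) * (C_sigma N sigma * h `^ (- sigma)).
Proof.
move=> sk su sv uv; rewrite -rsum_kappa -ge0_rsumZl ?subr_ge0//.
apply: (rsumB_le (su i) (sv i) (abs_convergentZ (v i - u i) sk)) => j _.
rewrite /fracLap_term -mulrBl ler_wpM2r ?kappa_ge0//.
by have := uv (i + j); lra.
Qed.

Theorem theorem3p3 (R : realType) (N : nat) (hN : (0 < N)%N)
    (sigma : R) (hsigma : 0 < sigma < 2) (T : R) (hT : 0 < T)
    (h : R) (hh : 0 < h) (M : nat) (hM : (0 < M)%N)
    (tau : R) (htau : tau = T / M%:R)
    (F : R -> R) (L_F : R) (hL : 0 < L_F)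
    (hF : forall l1 l2 : R, F l1 - F l2 <= L_F * Num.max 0 (l1 - l2))
    (CFL : tau <= (L_F * C_sigma N sigma)^-1 * h `^ sigma)
    (f : nat -> 'rV[int]_N -> R) (U V : nat -> 'rV[int]_N -> R)
    (hU : subsolution M sigma h tau F f U)
    (hV : supersolution M sigma h tau F f V)
    (h0 : forall j : 'rV[int]_N, U 0%N j <= V 0%N j) :
  forall n : nat, (1 <= n <= M)%N ->
  forall j : 'rV[int]_N, U n j <= V n j.
Proof.
have tau0 : 0 < tau by rewrite htau divr_gt0// ltr0n.
have hs0 : 0 < h `^ sigma by exact: powR_gt0.
(* The inverse keeps the sign and sends [0] to [0], so a positive [tau] below the CFL bound forces
   positivity. *)
have C0 : 0 < C_sigma N sigma.
  have : 0 < (L_F * C_sigma N sigma)^-1 * h `^ sigma := lt_le_trans tau0 CFL.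
  by rewrite pmulr_lgt0// invr_gt0 pmulr_rgt0.
have k0 : 0 < C_sigma N sigma * h `^ (- sigma) by rewrite mulr_gt0// powR_gt0.
have tauk : tau * (L_F * (C_sigma N sigma * h `^ (- sigma))) <= 1.
  move: CFL; rewrite powRN mulrC ler_pdivlMr ?mulr_gt0//.
  by rewrite !mulrA ler_pdivrMr// mul1r.
have sk : abs_convergent (@nonzero N) (kappa sigma h).
  apply: rsum_gt0_abs_convergent => [j|]; first exact: kappa_ge0.
  by rewrite rsum_kappa.
suff UV n : (n <= M)%N -> forall j, U n j <= V n j.
  by move=> n /andP[_ nM]; exact: UV.
elim: n => [//|n IH] nM i.
have {}IH := IH (ltnW nM).
have [dU /(_ i) leU] := hU n nM; have [dV /(_ i) geV] := hV n nM.
have W0 : 0 <= V n i - U n i by rewrite subr_ge0.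
set k := C_sigma N sigma * _ in k0 tauk.
have FUV : F (fracLap sigma h (U n) i) - F (fracLap sigma h (V n) i)
    <= L_F * ((V n i - U n i) * k).
  (* The bound must dominate both arguments of the maximum; it dominates [0] because
     [U n i <= V n i] and [0 < k]. *)
  apply: le_trans (hF _ _) _; rewrite ler_wpM2l ?(ltW hL)// ge_max.
  by rewrite mulr_ge0 ?(ltW k0)//= fracLapB_le.
(* The source [f] cancels, so [U n.+1 i - V n.+1 i] is at most
   [(V n i - U n i) * (tau * L_F * k - 1)], which is nonpositive. *)
have := ler_wpM2l (ltW tau0) FUV; have := ler_wpM2l W0 tauk.
have -> : tau * (L_F * ((V n i - U n i) * k))
  = (V n i - U n i) * (tau * (L_F * k)) by lra.
lra.
Qed.
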